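(* Let $\tau^{(1)}_{n,j}=\mathcal T^{(1)}_{n+3,j+3}$ for $n\ge0$ and $1\le j\le n+1$. The infinite sequence $[\tau^{(1)}_{1,1},\tau^{(1)}_{2,1},\tau^{(1)}_{3,1},\dots]$ is log-concave, hence a Pólya frequency sequence of order 2, and the infinite lower-triangular Toeplitz matrix $A=(A_{n,j})_{n\ge0,\,j\ge1}$ given by $A_{n,j}=\tau^{(1)}_{n,j}$ for $1\le j\le n$ and $A_{n,j}=0$ for $j\ge n+1$ is totally non-negative of order 2.
   Context: Define $\psi:\{1,2,3,\dots\}\to\{0,1,2,\dots\}$ by $\psi(1)=0$, $\psi(2)=1$, $\psi(3)=2$ and $\psi(j)=\sum_{k=1}^{j-1}\psi(k)$ for $j\ge 4$. The triangular array $\mathcal T=(\mathcal T_{n,j})$, $n\ge 0$, $1\le j\le n+1$, of integers is defined recursively by: $\mathcal T_{n,n+1}=1$ for every $n\ge 0$; $\mathcal T_{1,1}=1$, $\mathcal T_{2,2}=2$, $\mathcal T_{3,3}=3$; $\mathcal T_{n,n}=\sum_{k=1}^{n-2}\mathcal T_{n-k,n-k}$ for every $n\ge 4$; and $\mathcal T_{n,j}=\mathcal T_{n-1,j}+\psi(j)$ for every $n\ge 2$ and $1\le j\le n-1$. The normalised array is $\mathcal T^{(1)}_{n,j}=2^{-n}\mathcal T_{n,j}$. An infinite sequence $[a_1,a_2,\dots]$ of positive reals is log-concave if $a_{m-1}a_{m+1}\le a_m^2$ for all $m\ge2$. A sequence is a Pólya frequency sequence of order 2 if all minors of order at most 2 of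 its lower-triangular Toeplitz matrix are non-negative. A matrix is totally non-negative of order 2 if all its minors of order at most 2 are non-negative. *)

(* Defs.v *)
From HB Require Import structures.
From mathcomp Require Import all_boot all_order all_algebra.

Set Implicit Arguments.
Unset Strict Implicit.
Unset Printing Implicit Defensive.

Import Order.TTheory GRing.Theory Num.Theory.

Local Open Scope ring_scope.

(* Course-of-values recursion on nat: [cov F n = F n (cov F)] as soon as
   [F n f] only depends on the values of [f] below [n] (lemma [covE]);
   [cov_table F n] is the list of the first [n] values. *)
Fixpoint cov_table (V : nmodType) (F : nat -> (nat -> V) -> V) (n : nat)
    : seq V :=
  if n is m.+1
  then rcons (cov_table F m) (F m (fun i => nth 0 (cov_table F m) i))
  else [::].

Definition cov (V : nmodType) (F : nat -> (nat -> V) -> V) (n : nat) : V :=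
  nth 0 (cov_table F n.+1) n.

Lemma size_cov_table (V : nmodType) (F : nat -> (nat -> V) -> V) n :
  size (cov_table F n) = n.
Proof. by elim: n => //= n IHn; rewrite size_rcons IHn. Qed.

Lemma nth_cov_table (V : nmodType) (F : nat -> (nat -> V) -> V) n i :
  (i < n)%N -> nth 0 (cov_table F n) i = cov F i.
Proof.
elim: n => // n IHn; rewrite ltnS leq_eqVlt => /predU1P[-> //|lt_in].
by rewrite /= nth_rcons size_cov_table lt_in IHn.
Qed.

Lemma covE (V : nmodType) (F : nat -> (nat -> V) -> V) n :
    (forall f g : nat -> V,
        (forall i, (i < n)%N -> f i = g i) -> F n f = F n g) ->
  cov F n = F n (cov F).
Proof.
move=> FP; rewrite {1}/cov /= nth_rcons size_cov_table ltnn eqxx.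
by apply: FP => i; apply: nth_cov_table.
Qed.

(* The value at 0 is junk. *)
Definition psi : nat -> nat :=
  cov (fun j f => match j with
                  | 0 => 0%N
                  | 1 => 0%N
                  | 2 => 1%N
                  | 3 => 2%N
                  | _ => (\sum_(1 <= k < j) f k)%N
                  end).

Lemma psi_rec j : (4 <= j)%N -> psi j = (\sum_(1 <= k < j) psi k)%N.
Proof.
case: j => [|[|[|[|j]]]] // _; rewrite {1}/psi covE // => f g fg.
by apply: eq_big_nat => k /andP[_ /fg].
Qed.

Lemma psi123 : [/\ psi 1 = 0%N, psi 2 = 1%N & psi 3 = 2%N].
Proof. by []. Qed.

(* The diagonal entries T_{n,n}, which satisfy a recursion of their own; the
   value at 0 is junk. *)
Definition Tdiag : nat -> int :=
  cov (fun n f => match n with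
                  | 0 => 0
                  | 1 => 1
                  | 2 => 2
                  | 3 => 3
                  | _ => \sum_(1 <= k < n.-1) f (n - k)%N
                  end).

(* Entries outside 1 <= j <= n + 1 are 0. *)
Fixpoint Tarr (n j : nat) : int :=
  if j == n.+1 then 1
  else if j == n then Tdiag n
  else if n is m.+1 then
    if (1 <= j <= m)%N then Tarr m j + (psi j)%:Z else 0
  else 0.

Lemma TarrE n j : Tarr n j =
  if j == n.+1 then 1
  else if j == n then Tdiag n
  else if (1 <= j <= n.-1)%N then Tarr n.-1 j + (psi j)%:Z else 0.
Proof. by case: n j => [|n] [|j]. Qed.

Lemma Tarr_last n : Tarr n n.+1 = 1.
Proof. by rewrite TarrE eqxx. Qed.

Lemma Tarr_diagE n : Tarr n n = Tdiag n.
Proof. by rewrite TarrE ltn_eqF // eqxx. Qed.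

Lemma Tarr_diag123 : [/\ Tarr 1 1 = 1, Tarr 2 2 = 2 & Tarr 3 3 = 3].
Proof. by []. Qed.

Lemma Tarr_diag n : (4 <= n)%N ->
  Tarr n n = \sum_(1 <= k < n.-1) Tarr (n - k) (n - k).
Proof.
move=> n4; rewrite Tarr_diagE; under eq_bigr do rewrite Tarr_diagE.
case: n n4 => [|[|[|[|n]]]] // _; rewrite {1}/Tdiag covE // => f g fg.
apply: eq_big_nat => k /andP[k_gt0 _]; apply: fg.
by rewrite ltn_subrL k_gt0.
Qed.

Lemma Tarr_rec n j : (2 <= n)%N -> (1 <= j <= n.-1)%N ->
  Tarr n j = Tarr n.-1 j + (psi j)%:Z.
Proof.
case: n => // n _ j_in; have /andP[_ le_jn] := j_in.
by rewrite TarrE j_in !ltn_eqF // ltnS // leqW.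
Qed.

Definition T1 (R : realFieldType) (n j : nat) : R := 2 ^- n * (Tarr n j)%:~R.

Definition tau1 (R : realFieldType) (n j : nat) : R := T1 R (n + 3) (j + 3).

(* Sequences [a_1, a_2, ...] are functions on nat whose value at 0 is ignored. *)
Definition log_concave (R : realFieldType) (a : nat -> R) : Prop :=
  (forall m, (1 <= m)%N -> 0 < a m) /\
  (forall m, (2 <= m)%N -> a m.-1 * a m.+1 <= a m ^+ 2).

(* In the next three definitions, [M] is an infinite matrix with rows labelled
   by r0, r0 + 1, ... and columns labelled by c0, c0 + 1, ...; entries with
   other labels are ignored. *)
Definition totally_nonneg (R : realFieldType) (r0 c0 p : nat)
    (M : nat -> nat -> R) : Prop :=
  forall (k : nat) (r c : 'I_k -> nat), (1 <= k <= p)%N ->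
    (forall i, (r0 <= r i)%N) -> (forall i, (c0 <= c i)%N) ->
    {homo r : i j / (i < j)%N} -> {homo c : i j / (i < j)%N} ->
    0 <= \det (\matrix_(i < k, j < k) M (r i) (c j)).

Definition toeplitz (R : realFieldType) (r0 c0 : nat)
    (M : nat -> nat -> R) : Prop :=
  forall n j, (r0 <= n)%N -> (c0 <= j)%N -> M n.+1 j.+1 = M n j.

Definition lower_triangular (R : realFieldType) (r0 c0 : nat)
    (M : nat -> nat -> R) : Prop :=
  forall n j, (r0 <= n)%N -> (c0 <= j)%N -> (n < j)%N -> M n j = 0.

(* Rows and columns are labelled from 1, so a_1 is on the diagonal. *)
Definition toeplitz_mx (R : realFieldType) (a : nat -> R) (n j : nat) : R :=
  if (j <= n)%N then a (n - j).+1 else 0.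

Definition polya_frequency (R : realFieldType) (p : nat) (a : nat -> R) : Prop :=
  totally_nonneg 1 1 p (toeplitz_mx a).

(* Rows are labelled from 0 and columns from 1; row 0 is null. *)
Definition Amx (R : realFieldType) (n j : nat) : R :=
  if (1 <= j <= n)%N then tau1 R n j else 0.

(* Main.v *)
Require Import Defs.
From mathcomp Require Import all_boot all_order all_algebra.
From mathcomp Require Import zify ring lra.

(** Away from their initial values, both full-history recursions, the one for
    psi and the one for the diagonal of the array, just double the previous
    term: psi j = 3 * 2 ^ (j - 4) and T_{j,j} = 5 * 2 ^ (j - 4) for j >= 4.
    Going down column j adds psi j at each step, so
    T_{j+d,j} = 2 ^ (j - 4) * (5 + 3 d), and dividing by 2 ^ (j + d) leaves a
    quantity that depends on d only (lemma [tau1E]):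
    tau_{j+d,j} = (5 + 3 d) / 2 ^ (d + 4).
    This is why the matrix is Toeplitz, with first column the given sequence.
    The sequence is log-concave because it is a geometric sequence times an
    arithmetic one: (5 + 3 (d - 1)) (5 + 3 (d + 1)) = (5 + 3 d) ^ 2 - 9.

    Total non-negativity of order 2 holds for the Toeplitz matrix of any
    log-concave sequence (lemma [log_concave_totally_nonneg]).  A 2 x 2 minor
    either has a zero in its upper right corner, or it is
    a_{m+s} a_{m+t} - a_m a_{m+s+t}, whose sign is the usual strengthening of
    log-concavity from neighbours to arbitrary gaps (lemma [log_concave_gap]). *)

Import Order.TTheory GRing.Theory Num.Theory.

Local Open Scope ring_scope.

Lemma psi_geometric i : psi (i + 4)%N = (3 * 2 ^ i)%N.
Proof.
elim: i => [|i IHi]; first by rewrite psi_rec // unlock.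
rewrite addSn psi_rec ?big_nat_recr /=; [|lia..].
by rewrite -psi_rec ?leq_addl // IHi expnS; lia.
Qed.

Lemma Tarr_diag_geometric i : Tarr (i + 4)%N (i + 4)%N = 5 * 2 ^+ i.
Proof.
elim: i => [|i IHi]; first by rewrite Tarr_diag // unlock.
rewrite addSn Tarr_diag /=; last by lia.
(* The k = 1 term is the previous diagonal entry, and the remaining terms,
   shifted by one, are the recursion for that same entry. *)
rewrite big_ltn; last by lia.
rewrite big_add1 subSS subn0.
under eq_bigr do rewrite subSS.
rewrite -Tarr_diag; last by lia.
by rewrite IHi exprS; ring.
Qed.

(** Descending from the diagonal, column i + 4 grows arithmetically, with
    step psi (i + 4). *)
Lemma Tarr_column i d :
  Tarr (i + d + 4)%N (i + 4)%N = 2 ^+ i * (5 + 3 * d%:R).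
Proof.
elim: d => [|d IHd]; first by rewrite addn0 Tarr_diag_geometric; ring.
rewrite (addnS i) addSn Tarr_rec /=; [|lia..].
by rewrite IHd psi_geometric PoszM -rmorphXn -natr1 /=; ring.
Qed.

Lemma tau1E (R : realFieldType) (j d : nat) :
  tau1 R (j.+1 + d)%N j.+1 = 2 ^- (d + 4) * (5 + 3 * d%:R).
Proof.
rewrite /tau1 /T1 (_ : (j.+1 + d + 3 = j + d + 4)%N); last by lia.
rewrite (_ : (j.+1 + 3 = j + 4)%N); last by lia.
rewrite Tarr_column !rmorphM rmorphD rmorphM rmorphXn /= !rmorph_nat.
rewrite -addnA (exprD _ j) invfM mulrACA [_ * (2 ^+ j)]mulrC !mulrA.
by rewrite divff ?mul1r // expf_neq0 // pnatr_eq0.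
Qed.

Lemma log_concave_tau1 (R : realFieldType) :
  log_concave (fun m => tau1 R m 1).
Proof.
have E d : tau1 R d.+1 1 = 2 ^- (d + 4) * (5 + 3 * d%:R).
  by rewrite -add1n tau1E.
split=> [[|d]|[|[|d]]] //= _.
  by rewrite E mulr_gt0 ?invr_gt0 ?exprn_gt0 // -natrM -natrD ltr0n.
rewrite !E expr2 -(natr1 d.+1) -(natr1 d) !addSn !exprS !invfM.
set q := (2 ^+ (d + 4))^-1; set x := d%:R : R.
(* The difference of the two sides is 9 * (q / 2) ^ 2. *)
have := sqr_ge0 q; lra.
Qed.

Lemma det_mx2 (R : comPzRingType) (A : 'M[R]_2) :
  \det A = A 0 0 * A 1 1 - A 0 1 * A 1 0.
Proof.
rewrite (expand_det_row _ 0) 2!big_ord_recl big_ord0 addr0.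
rewrite /cofactor !det_mx11 !mxE /= expr0 expr1 mul1r mulN1r mulrN.
by congr (A _ _ * A _ _ - A _ _ * A _ _); apply: val_inj.
Qed.

Section LogConcave.

Context (R : realFieldType) (a : nat -> R).
Hypothesis lc_a : log_concave a.

Let a_gt0 m : 0 < a m.+1.
Proof. exact: lc_a.1. Qed.

(** Log-concavity says that the ratios a_{k+1} / a_k do not increase from one k
    to the next; chaining this t times compares the ratios at m + 1 and at
    m + t + 1. *)
Lemma log_concave_gap1 m t : a m.+1 * a (m + t).+2 <= a m.+2 * a (m + t).+1.
Proof.
elim: t => [|t IHt]; first by rewrite addn0 mulrC.
rewrite addnS -(ler_pM2r (a_gt0 (m + t))).
have /= lc := lc_a.2 (m + t).+2 isT.
apply: (@le_trans _ _ (a m.+1 * a (m + t).+2 ^+ 2)).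
  by rewrite -mulrA ler_pM2l // mulrC.
by rewrite expr2 mulrA [leRHS]mulrAC ler_pM2r.
Qed.

(** By the monotonicity of the ratios a_{k+1} / a_k, each of the s ratios after
    index m dominates the one t places later, and their products compare in
    the same way.  Without divisions, each induction step is checked after
    multiplying both sides by the positive term a_{m+s+1}. *)
Lemma log_concave_gap m s t :
  a m.+1 * a (m + s + t).+1 <= a (m + s).+1 * a (m + t).+1.
Proof.
elim: s => [|s IHs]; first by rewrite addn0.
rewrite addnS addSn -(ler_pM2l (a_gt0 (m + s))).
apply: (@le_trans _ _ (a m.+1 * (a (m + s).+2 * a (m + s + t).+1))).
  by rewrite mulrCA ler_pM2l // log_concave_gap1.
by rewrite mulrCA [leRHS]mulrCA ler_pM2l.
Qed.

Lemma toeplitz_mx_ge0 n j : 0 <= toeplitz_mx a n j.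
Proof. by rewrite /toeplitz_mx; case: ifP => // _; apply: ltW. Qed.

(** If the column labels of a 2 x 2 minor are c < d and the row labels r < s
    with d <= r, then the four entries are terms of the sequence and the minor
    is the gap inequality with base index r - d and gaps d - c and s - r.  If
    r < d, the entry in row r and column d vanishes. *)
Lemma log_concave_totally_nonneg r0 c0 :
  totally_nonneg r0 c0 2 (toeplitz_mx a).
Proof.
move=> [|[|[|k]]] // r c _ _ _ r_incr c_incr.
  by rewrite det_mx11 mxE toeplitz_mx_ge0.
rewrite det_mx2 !mxE subr_ge0.
move: (r_incr 0 1 isT) (c_incr 0 1 isT) => {r_incr c_incr}.
move: (r 0) (r 1) (c 0) (c 1) => {r c} r s c d lt_rs lt_cd.
have [le_dr | lt_rd] := leqP d r; last first.
  by rewrite {1}/toeplitz_mx leqNgt lt_rd mul0r mulr_ge0 ?toeplitz_mx_ge0.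
rewrite /toeplitz_mx le_dr !ifT; [|lia..].
have := log_concave_gap (r - d) (d - c) (s - r).
have -> : (r - d + (d - c) = r - c)%N by lia.
have -> : (r - c + (s - r) = s - c)%N by lia.
by have -> : (r - d + (s - r) = s - d)%N by lia.
Qed.

End LogConcave.

Lemma AmxE (R : realFieldType) n j : (1 <= j)%N ->
  Amx R n j = toeplitz_mx (fun m => tau1 R m 1) n j.
Proof.
case: j => // j _; rewrite /Amx /toeplitz_mx /=.
case: leqP => // le_jn.
by rewrite -[in tau1 R n _](subnKC le_jn) tau1E -[(n - _).+1]add1n tau1E.
Qed.

Theorem mainTheorem8 (R : realFieldType) :
  [/\ log_concave (fun m => tau1 R m 1),
      polya_frequency 2 (fun m => tau1 R m 1),
      lower_triangular 0 1 (Amx R),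
      toeplitz 0 1 (Amx R)
    & totally_nonneg 0 1 2 (Amx R)].
Proof.
have lc := log_concave_tau1 R.
split=> //.
- exact: log_concave_totally_nonneg.
- by move=> n j _ j_gt0 lt_nj; rewrite AmxE // /toeplitz_mx leqNgt lt_nj.
- by move=> n j _ j_gt0; rewrite !AmxE // /toeplitz_mx ltnS subSS.
- move=> k r c k_in r_ge c_ge r_incr c_incr.
  under eq_mx do rewrite AmxE //.
  exact: (log_concave_totally_nonneg R _ lc 0 1).
Qed.
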